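(* Let $n\in\mathbb{Z}$. For every $q\in\mathbb{Z}$ and $M=E_{T_{(2,2n+1)}}(1/q)$, set $$\tau_{n,q}=\frac{|(4n+2)q-1|-1}{2}.$$ Then a basis of the $\mathbb{C}$-vector space $\mathbb{C}[X(M)]$ is given by $$B=\{\,t_m^i\,t_b^j\ :\ 0\le i<\tau_{n,q}\ \text{and}\ 0\le j<n\,\}\cup\{\,t_m^{\tau_{n,q}}\,\}.$$
   Context: $K=T_{(2,2n+1)}$ is the $(2,2n+1)$-torus knot in $S^3$, $E_K$ the complement of an open tubular neighborhood of it. Its group has the presentation $\pi_1(E_K)=\langle a,b\mid a^2=b^{2n+1}\rangle$, with meridian $m=ab^{-n}$ and longitude $\ell=a^2m^{-4n-2}$. $E_K(1/q)$ is the Dehn filling along the slope $m\,\ell^{q}$, so $\pi_1(M)=\pi_1(E_K)/\langle\langle m\ell^q\rangle\rangle$. $X(M)$ is the algebraic set of $SL_2(\mathbb{C})$-characters of $\pi_1(M)$ and $\mathbb{C}[X(M)]$ its (reduced) coordinate ring. For $\gamma\in\pi_1(M)$, $t_\gamma\in\mathbb{C}[X(M)]$ is the trace function $t_\gamma([\rho])=\mathrm{Tr}\,\rho(\gamma)$; here $m$ and $b$ also denote their images in $\pi_1(M)$.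
   Formalization: The range 0 ≤ j < n is replaced by 0 ≤ j < max(n, −n−1). This agrees with the text for n ≥ −1 or q = 0; for n ≤ −2 and q ≠ 0 the literal B is one element while dim C[X(M)] > 1 (e.g. n = −2, q = 1 gives dimension 4). *)

(* Defs.v *)
From HB Require Import structures.
From mathcomp Require Import all_boot all_order all_algebra generic_quotient.
From mathcomp Require Import complex.
From mathcomp Require Import boolp classical_sets functions reals.

Set Implicit Arguments.
Unset Strict Implicit.
Unset Printing Implicit Defensive.

Import GRing.Theory Num.Theory.
Local Open Scope quotient_scope.
Local Open Scope classical_set_scope.
Local Open Scope group_scope.

(* x ^ k with k : int; group_scope already uses x ^ y for conjugation. *)
Definition expgz (G : groupType) (x : G) (k : int) : G :=
  match k with Posz i => x ^+ i | Negz i => x ^- i.+1 end.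

Notation "x ^^ k" := (expgz x k) (at level 30, right associativity) : group_scope.

Section FreeGroup.
Variable X : choiceType.

(* The letter (x, true) stands for x and (x, false) for its inverse. *)
Definition word : Type := seq (X * bool).
HB.instance Definition _ := Choice.on word.

Inductive free_eq : word -> word -> Prop :=
| free_refl u : free_eq u u
| free_sym u v : free_eq u v -> free_eq v u
| free_trans v u w : free_eq u v -> free_eq v w -> free_eq u w
| free_cancel u x e v : free_eq (u ++ (x, e) :: (x, ~~ e) :: v) (u ++ v).

Definition word_inv (u : word) : word := rev [seq (l.1, ~~ l.2) | l <- u].

Lemma free_eq_catl w u v : free_eq u v -> free_eq (w ++ u) (w ++ v).
Proof.
elim=> {u v} [u|u v _|v u t _ IH1 _|u x e v].
- exact: free_refl.
- exact: free_sym.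
- exact: free_trans IH1.
- by rewrite !catA; apply: free_cancel.
Qed.

Lemma free_eq_catr w u v : free_eq u v -> free_eq (u ++ w) (v ++ w).
Proof.
elim=> {u v} [u|u v _|v u t _ IH1 _|u x e v].
- exact: free_refl.
- exact: free_sym.
- exact: free_trans IH1.
- by rewrite -!catA /=; apply: free_cancel.
Qed.

Lemma free_eq_cat u u' v v' :
  free_eq u u' -> free_eq v v' -> free_eq (u ++ v) (u' ++ v').
Proof.
move=> uu' vv'; apply: (free_trans (free_eq_catr v uu')).
exact: free_eq_catl.
Qed.

Lemma word_inv_cat u v : word_inv (u ++ v) = word_inv v ++ word_inv u.
Proof. by rewrite /word_inv map_cat rev_cat. Qed.

Lemma word_invK : involutive word_inv.
Proof.
move=> u; rewrite /word_inv map_rev revK -map_comp -[RHS]map_id.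
by apply: eq_map => -[x e] /=; rewrite negbK.
Qed.

Lemma free_eq_inv u v : free_eq u v -> free_eq (word_inv u) (word_inv v).
Proof.
elim=> {u v} [u|u v _|v u t _ IH1 _|u x e v].
- exact: free_refl.
- exact: free_sym.
- exact: free_trans IH1.
- rewrite !word_inv_cat.
  rewrite {1}/word_inv /= !rev_cons -!cats1 -!catA /= -/(word_inv v).
  by have := free_cancel (word_inv v) x e (word_inv u); rewrite negbK.
Qed.

Lemma free_eq_mulV u : free_eq (u ++ word_inv u) [::].
Proof.
elim: u => [|[x e] u IH]; first exact: free_refl.
rewrite /word_inv /= rev_cons -cats1 -/(word_inv u).
have := free_eq_catl [:: (x, e)] (free_eq_catr [:: (x, ~~ e)] IH).
rewrite -catA => /free_trans; apply.
exact: (free_cancel [::] x e [::]).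
Qed.

Definition free_eqb : rel word := fun u v => `[< free_eq u v >].

Lemma free_eqb_equiv : equiv_class_of free_eqb.
Proof.
split=> [u|u v|v u w].
- by apply/asboolP; apply: free_refl.
- by apply/asbool_equiv_eq; split; apply: free_sym.
- by move=> /asboolP uv /asboolP vw; apply/asboolP; apply: free_trans vw.
Qed.

Canonical free_eqb_rel := EquivRelPack free_eqb_equiv.

Definition free_group : Type := {eq_quot free_eqb}.
HB.instance Definition _ := Choice.on free_group.
HB.instance Definition _ := EqQuotient.on free_group.

Definition free_one : free_group := \pi_free_group [::].
Definition free_mul (g h : free_group) : free_group :=
  \pi_free_group (repr g ++ repr h).
Definition free_inv (g : free_group) : free_group :=
  \pi_free_group (word_inv (repr g)).

Lemma free_piE u v : (\pi_free_group u = \pi_free_group v) <-> free_eq u v.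
Proof.
split=> [/eqP|uv]; first by rewrite eqmodE => /asboolP.
by apply/eqP; rewrite eqmodE; apply/asboolP.
Qed.

Lemma free_repr u : free_eq (repr (\pi_free_group u)) u.
Proof. by apply/free_piE; rewrite reprK. Qed.

Lemma free_mulE u v :
  free_mul (\pi_free_group u) (\pi_free_group v) = \pi_free_group (u ++ v).
Proof. by apply/free_piE; apply: free_eq_cat; apply: free_repr. Qed.

Lemma free_invE u :
  free_inv (\pi_free_group u) = \pi_free_group (word_inv u).
Proof. by apply/free_piE; apply: free_eq_inv; apply: free_repr. Qed.

Lemma free_mulA : associative free_mul.
Proof.
elim/quotW=> u; elim/quotW=> v; elim/quotW=> w.
by rewrite (free_mulE v w) (free_mulE u v) !free_mulE catA.
Qed.

Lemma free_mul1g : left_id free_one free_mul.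
Proof. by elim/quotW=> u; rewrite free_mulE. Qed.

Lemma free_mulg1 : right_id free_one free_mul.
Proof. by elim/quotW=> u; rewrite free_mulE cats0. Qed.

Lemma free_mulgV : right_inverse free_one free_inv free_mul.
Proof.
elim/quotW=> u; rewrite free_invE free_mulE.
by apply/free_piE; apply: free_eq_mulV.
Qed.

Lemma free_mulVg : left_inverse free_one free_inv free_mul.
Proof.
elim/quotW=> u; rewrite free_invE free_mulE.
apply/free_piE; rewrite -{2}[u]word_invK; exact: free_eq_mulV.
Qed.

HB.instance Definition _ := isGroup.Build free_group
  free_mulA free_mul1g free_mulg1 free_mulVg free_mulgV.

Definition free_gen (x : X) : free_group := \pi_free_group [:: (x, true)].

End FreeGroup.

Section NormalQuotient.
Variables (G : groupType) (S : set G).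

Inductive normal_closure : G -> Prop :=
| ncl_gen s : S s -> normal_closure s
| ncl_one : normal_closure 1
| ncl_mul g h : normal_closure g -> normal_closure h -> normal_closure (g * h)
| ncl_inv g : normal_closure g -> normal_closure g^-1
| ncl_conj g h : normal_closure g -> normal_closure (g ^ h).

Definition ncl_eqb : rel G := fun g h => `[< normal_closure (g * h^-1) >].

Lemma ncl_eqb_equiv : equiv_class_of ncl_eqb.
Proof.
have sym g h : normal_closure (g * h^-1) -> normal_closure (h * g^-1).
  by move=> /ncl_inv; rewrite invgM invgK.
split=> [g|g h|h g k].
- by apply/asboolP; rewrite mulgV; apply: ncl_one.
- by apply/asbool_equiv_eq; split; apply: sym.
- move=> /asboolP gh /asboolP hk; apply/asboolP.
  by have := ncl_mul gh hk; rewrite -mulgA mulKg.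
Qed.

Canonical ncl_eqb_rel := EquivRelPack ncl_eqb_equiv.

Definition normal_quot : Type := {eq_quot ncl_eqb}.
HB.instance Definition _ := Choice.on normal_quot.
HB.instance Definition _ := EqQuotient.on normal_quot.

Definition nquot_pi (g : G) : normal_quot := \pi_normal_quot g.
Definition nquot_one : normal_quot := nquot_pi 1.
Definition nquot_mul (x y : normal_quot) : normal_quot :=
  nquot_pi (repr x * repr y).
Definition nquot_inv (x : normal_quot) : normal_quot := nquot_pi (repr x)^-1.

Lemma nquot_piP g h : nquot_pi g = nquot_pi h <-> normal_closure (g * h^-1).
Proof.
split=> [/eqP|gh]; first by rewrite eqmodE => /asboolP.
by apply/eqP; rewrite eqmodE; apply/asboolP.
Qed.

Lemma nquot_repr g : normal_closure (repr (nquot_pi g) * g^-1).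
Proof. by apply/nquot_piP; rewrite /nquot_pi reprK. Qed.

Lemma nquot_mulE g h :
  nquot_mul (nquot_pi g) (nquot_pi h) = nquot_pi (g * h).
Proof.
apply/nquot_piP; set g' := repr _; set h' := repr _.
have -> : g' * h' * (g * h)^-1 = (h' * h^-1) ^ g'^-1 * (g' * g^-1).
  by rewrite conjgE invgK invgM !mulgA mulgVK.
by apply: ncl_mul; [apply: ncl_conj|]; apply: nquot_repr.
Qed.

Lemma nquot_invE g : nquot_inv (nquot_pi g) = nquot_pi g^-1.
Proof.
apply/nquot_piP; set g' := repr _; rewrite invgK.
have -> : g'^-1 * g = (g' * g^-1)^-1 ^ g.
  by rewrite conjgE invgM invgK mulgA mulKg.
by apply: ncl_conj; apply: ncl_inv; apply: nquot_repr.
Qed.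

Lemma nquot_mulA : associative nquot_mul.
Proof.
elim/quotW=> g; elim/quotW=> h; elim/quotW=> k.
by rewrite -!/(nquot_pi _) (nquot_mulE h k) (nquot_mulE g h) !nquot_mulE mulgA.
Qed.

Lemma nquot_mul1g : left_id nquot_one nquot_mul.
Proof. by elim/quotW=> g; rewrite -/(nquot_pi _) nquot_mulE mul1g. Qed.

Lemma nquot_mulg1 : right_id nquot_one nquot_mul.
Proof. by elim/quotW=> g; rewrite -/(nquot_pi _) nquot_mulE mulg1. Qed.

Lemma nquot_mulVg : left_inverse nquot_one nquot_inv nquot_mul.
Proof.
by elim/quotW=> g; rewrite -/(nquot_pi _) nquot_invE nquot_mulE mulVg.
Qed.

Lemma nquot_mulgV : right_inverse nquot_one nquot_inv nquot_mul.
Proof.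
by elim/quotW=> g; rewrite -/(nquot_pi _) nquot_invE nquot_mulE mulgV.
Qed.

HB.instance Definition _ := isGroup.Build normal_quot
  nquot_mulA nquot_mul1g nquot_mulg1 nquot_mulVg nquot_mulgV.

End NormalQuotient.

Arguments nquot_pi {G} S g.

Section TorusKnot.
Variables (n q : int).

Local Notation fa := (free_gen true).
Local Notation fb := (free_gen false).

Definition torus_relator : free_group bool :=
  fa ^+ 2 * (fb ^^ (2 * n + 1)%R)^-1.

Definition torus_knot_group : groupType :=
  normal_quot [set torus_relator].

Definition knot_a : torus_knot_group := nquot_pi [set torus_relator] fa.
Definition knot_b : torus_knot_group := nquot_pi [set torus_relator] fb.
Definition knot_meridian : torus_knot_group := knot_a * knot_b ^^ (- n)%R.
Definition knot_longitude : torus_knot_group :=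
  knot_a ^+ 2 * knot_meridian ^^ (- 4 * n - 2)%R.

Definition filling_slope : torus_knot_group :=
  knot_meridian * knot_longitude ^^ q.

Definition filling_group : groupType := normal_quot [set filling_slope].

Definition filling_m : filling_group :=
  nquot_pi [set filling_slope] knot_meridian.
Definition filling_b : filling_group :=
  nquot_pi [set filling_slope] knot_b.

(* The division by 2 is exact: (4n+2)q-1 is odd. *)
Definition tau : nat := (`|((4 * n + 2) * q - 1)%R|%N.-1)./2.

(* The genus (|2n+1|-1)/2 of the torus knot T(2,2n+1), i.e. n if 0 <= n and
   -n-1 if n < 0, where T(2,2n+1) is the mirror image of T(2,2(-n-1)+1).
   It bounds the exponent of t_b in the basis: with the bound n itself the
   basis would be a single element for n < 0, although the character variety
   then has more than one point as soon as n < -1 and q != 0. *)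
Definition torus_genus : int := Num.max n (- n - 1)%R.

End TorusKnot.

Local Open Scope ring_scope.

Section SL2.
Variable K : comUnitRingType.

Definition is_SL2 (A : 'M[K]_2) := \det A == 1.
Definition SL2 : Type := {A : 'M[K]_2 | is_SL2 A}.
HB.instance Definition _ := Choice.on SL2.
HB.instance Definition _ := SubType.on SL2.

Fact SL2_one_subproof : is_SL2 1%:M.
Proof. by rewrite /is_SL2 det1. Qed.

Fact SL2_mul_subproof (A B : SL2) : is_SL2 (val A *m val B).
Proof.
by case: A B => [A dA] [B dB]; rewrite /is_SL2 det_mulmx (eqP dA) (eqP dB) mulr1.
Qed.

Fact SL2_inv_subproof (A : SL2) : is_SL2 (invmx (val A)).
Proof. by case: A => [A dA]; rewrite /is_SL2 det_inv (eqP dA) invr1. Qed.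

Definition SL2_one : SL2 := exist is_SL2 _ SL2_one_subproof.
Definition SL2_mul (A B : SL2) : SL2 := exist is_SL2 _ (SL2_mul_subproof A B).
Definition SL2_inv (A : SL2) : SL2 := exist is_SL2 _ (SL2_inv_subproof A).

Lemma SL2_unit (A : SL2) : val A \in unitmx.
Proof. by case: A => [A dA]; rewrite unitmxE (eqP dA) unitr1. Qed.

Lemma SL2_mulA : associative SL2_mul.
Proof. by move=> A B D; apply: val_inj; rewrite /= mulmxA. Qed.
Lemma SL2_mul1g : left_id SL2_one SL2_mul.
Proof. by move=> A; apply: val_inj; rewrite /= mul1mx. Qed.
Lemma SL2_mulg1 : right_id SL2_one SL2_mul.
Proof. by move=> A; apply: val_inj; rewrite /= mulmx1. Qed.
Lemma SL2_mulVg : left_inverse SL2_one SL2_inv SL2_mul.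
Proof. by move=> A; apply: val_inj; rewrite /= mulVmx ?SL2_unit. Qed.
Lemma SL2_mulgV : right_inverse SL2_one SL2_inv SL2_mul.
Proof. by move=> A; apply: val_inj; rewrite /= mulmxV ?SL2_unit. Qed.

HB.instance Definition _ := isGroup.Build SL2
  SL2_mulA SL2_mul1g SL2_mulg1 SL2_mulVg SL2_mulgV.

End SL2.

Section CharacterVariety.
Variables (R : realType) (G : groupType).
Local Notation C := R[i].

Definition sl2_character (rho : {multiplicative G -> SL2 C}) : G -> C :=
  fun g => \tr (val (rho g)).

(* A subset of the affine space C^G with coordinates the t_g. *)
Definition char_variety : Type :=
  {chi : G -> C | exists rho, chi = sl2_character rho}.

(* C^o is C with its structure of C-module, so that functions form a
   C-algebra. *)
Definition trace_map (g : G) : char_variety -> C^o := fun chi => sval chi g.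

(* Polynomials in the coordinates t_g, restricted to the character variety. *)
Inductive is_regular : (char_variety -> C^o) -> Prop :=
| regular_const (c : C) : is_regular (fun=> c)
| regular_trace g : is_regular (trace_map g)
| regular_add f h : is_regular f -> is_regular h -> is_regular (f + h)
| regular_mul f h : is_regular f -> is_regular h -> is_regular (f * h).

Definition regular : {pred char_variety -> C^o} := fun f => `[< is_regular f >].

Lemma regular_scale (c : C) f : is_regular f -> is_regular (c *: f).
Proof. by move=> rf; apply: (regular_mul (regular_const c) rf). Qed.

Fact regular_subring_closed : subring_closed regular.
Proof.
split=> [|f h /asboolP rf /asboolP rh|f h /asboolP rf /asboolP rh].
- by apply/asboolP; apply: (regular_const 1).
- apply/asboolP; rewrite -scaleN1r; apply: regular_add => //.
  exact: regular_scale.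
- by apply/asboolP; apply: regular_mul.
Qed.

HB.instance Definition _ :=
  GRing.isSubringClosed.Build (char_variety -> C^o) regular
    regular_subring_closed.

Fact regular_scaler_closed : GRing.scaler_closed regular.
Proof.
by move=> c f /asboolP rf; apply/asboolP; apply: regular_scale.
Qed.

HB.instance Definition _ :=
  GRing.isScaleClosed.Build C (char_variety -> C^o) regular
    regular_scaler_closed.

Definition coord_ring : Type := {f : char_variety -> C^o | regular f}.
HB.instance Definition _ := Choice.on coord_ring.
HB.instance Definition _ := SubType.on coord_ring.
HB.instance Definition _ := 
  GRing.SubChoice_isSubComPzRing.Build (char_variety -> C^o) regular coord_ring
    regular_subring_closed.
HB.instance Definition _ := [SubZmodule_isSubLmodule of coord_ring by <:].

Fact trace_subproof g : regular (trace_map g).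
Proof. by apply/asboolP; apply: regular_trace. Qed.

Definition trace_fun (g : G) : coord_ring := exist regular _ (trace_subproof g).

End CharacterVariety.

Section Basis.
Variables (K : fieldType) (V : lmodType K).
Implicit Types (B : set V).

Definition lin_indep B := forall (s : seq V) (c : V -> K),
  uniq s -> [set` s] `<=` B -> \sum_(v <- s) c v *: v = 0 ->
  forall v, v \in s -> c v = 0.

Definition spanning B := forall w : V, exists (s : seq V) (c : V -> K),
  [set` s] `<=` B /\ w = \sum_(v <- s) c v *: v.

Definition is_basis B := lin_indep B /\ spanning B.

End Basis.

(* Main.v *)
(** In a representation with matrices A, B for a, b, the matrix A^2 = B^(2n+1)
    commutes with B. If tr A <> 0, then A is a combination of 1 and A^2, so A
    and B commute, the longitude is trivial, and so is the representation.
    Otherwise A^2 = -1, hence B^(2n+1) = -1, and the filling relation reads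
    M^N = (-1)^q with N = |(4n+2)q-1|. So (tr M, tr B) is either (2,2) or a
    point of a grid X * Y with tau * genus points, where X and Y consist of the
    numbers z + 1/z, for z a root of (-1)^q, resp. -1, of odd order, other than
    (-1)^q, resp. -1, itself. All these points occur, once each: since
    b = a^2 c^2 for c = b^(-n), and ac = m, a character is determined by its
    values at a, c and m.

    On such a set, if a combination of the proposed basis vanishes on the grid,
    it is a multiple of the polynomial prod_{x in X} (t_m - x), which does not
    vanish at (2,2). Hence the proposed basis is free, and it has as many
    elements as there are points. *)

From HB Require Import structures.
Require Import Defs.
From mathcomp Require Import all_boot all_order all_algebra generic_quotient.
From mathcomp Require Import cyclic separable cyclotomic ring zify.
From mathcomp Require Import complex boolp classical_sets functions reals.

Set Implicit Arguments.
Unset Strict Implicit.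
Unset Printing Implicit Defensive.

Import Order.TTheory GRing.Theory Num.Theory.
Local Open Scope quotient_scope.
Local Open Scope classical_set_scope.
Local Open Scope ring_scope.

(** * Traces of roots of 1 and of -1 *)

(** In characteristic 0 the polynomial X^n - 1 is separable, so its [n] roots are distinct, which is
    what [has_prim_root] needs. *)
Lemma primitive_root_exists (K : numClosedFieldType) (n : nat) :
  (0 < n)%N -> exists z : K, n.-primitive_root z.
Proof.
move=> n_gt0; pose p : {poly K} := 'X^n - 1.
have [r Dp] := closed_field_poly_normal p.
rewrite (monicP _) ?monicXnsubC // scale1r in Dp.
have rn1: all n.-unity_root r by apply/allP=> z; rewrite -root_prod_XsubC -Dp.
have sz_r: (n < (size r).+1)%N.
  by rewrite -(size_prod_XsubC r id) -Dp size_XnsubC.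
have [|z] := hasP (has_prim_root n_gt0 rn1 _ sz_r); last by exists z.
by rewrite -separable_prod_XsubC -Dp separable_Xn_sub_1 // pnatr_eq0 -lt0n.
Qed.

Lemma addrV_eq (K : fieldType) (a b : K) : a != 0 -> b != 0 ->
  a + a^-1 = b + b^-1 -> a = b \/ a * b = 1.
Proof.
move=> a0 b0 /eqP; rewrite -subr_eq0.
have -> : a + a^-1 - (b + b^-1) = (a - b) * (a * b - 1) / (a * b).
  by field; apply/andP.
rewrite !mulf_eq0 invr_eq0 (mulf_eq0 a b) (negPf a0) (negPf b0) !orbF !subr_eq0.
by case/orP=> /eqP; [left|right].
Qed.

(** For [e] = 1 or -1 over a closed field, these are the traces of the matrices of SL_2 other than
    [e *: 1] whose power of exponent 2k+1 is [e *: 1]. *)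
Definition root_trace (K : fieldType) (k : nat) (e x : K) :=
  exists z, [/\ z ^+ k.*2.+1 = e, z != e & x = z + z^-1].

(** The solutions of z^(2k+1) = e are e w^i with w a primitive root of unity of order 2k+1. As 1/e =
    e, inversion exchanges i and 2k+1-i. The order being odd, it fixes only i = 0, which is the
    excluded z = e, so i = 1, ..., k represent all traces once each. *)
Lemma root_traces_enum (K : numClosedFieldType) (k : nat) (e : K) : e ^+ 2 = 1 ->
  exists s : seq K,
    [/\ uniq s, size s = k & forall x, x \in s <-> root_trace k e x].
Proof.
move=> e2; have [w wP] := @primitive_root_exists K k.*2.+1 isT.
have w0 : w != 0.
  apply: contra_eq_neq (prim_expr_order wP) => ->.
  by rewrite expr0n eq_sym oner_eq0.
have e0 : e != 0 by rewrite -sqrf_eq0 e2 oner_eq0.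
have eV : e^-1 = e by apply: (mulfI e0); rewrite mulfV // -expr2 e2.
have eN : e ^+ k.*2.+1 = e by rewrite exprS -mul2n exprM e2 expr1n mulr1.
have w1 i : (i < k)%N -> w ^+ i.+1 != 1.
  by move=> ik; rewrite -(prim_order_dvd wP) gtnNdvd //; lia.
exists [seq e * w ^+ i.+1 + (e * w ^+ i.+1)^-1 | i <- iota 0 k]; split.
- rewrite map_inj_in_uniq ?iota_uniq // => i j.
  rewrite !mem_iota /= add0n => ik jk.
  case/addrV_eq; rewrite ?mulf_neq0 ?expf_neq0 //.
    move/(mulfI e0)/eqP; rewrite (eq_prim_root_expr wP).
    by rewrite !modn_small; [case/eqP| |]; lia.
  move/eqP; rewrite mulrACA -expr2 e2 mul1r -exprD -(prim_order_dvd wP).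
  rewrite gtnNdvd //; lia.
- by rewrite size_map size_iota.
move=> x; split=> [xs|[z [zN ze ->]]].
  case: (mapP xs) => i.
  rewrite mem_iota /= add0n => ik ->; exists (e * w ^+ i.+1); split=> //.
    by rewrite exprMn eN exprAC (prim_expr_order wP) expr1n mulr1.
  by rewrite -[X in _ != X]mulr1 (inj_eq (mulfI e0)) w1.
have z0 : z != 0 by apply: contraNneq e0 => z0; rewrite -zN z0 expr0n.
have ezN : (e * z) ^+ k.*2.+1 = 1 by rewrite exprMn eN zN -expr2 e2.
have [[i /= iN] ezi] := prim_rootP wP ezN.
have zE : z = e * w ^+ i by rewrite -ezi mulrA -expr2 e2 mul1r.
have i0 : (0 < i)%N.
  by rewrite lt0n; apply: contraNneq ze => i0; rewrite zE i0 mulr1.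
have [ik|ki] := leqP i k; apply/mapP.
  by exists i.-1; rewrite ?mem_iota ?zE ?prednK //=; lia.
have wV : (e * w ^+ (k.*2.+1 - i))^-1 = z.
  rewrite invfM eV zE; congr (_ * _).
  apply: (mulfI (expf_neq0 (k.*2.+1 - i) w0)).
  by rewrite mulfV ?expf_neq0 // -exprD subnK ?(prim_expr_order wP) // ltnW.
exists (k.*2.+1 - i).-1; first by rewrite mem_iota /=; lia.
by rewrite prednK ?subn_gt0 // wV addrC -[in z^-1]wV invrK.
Qed.

(** z + 1/z = 2 forces z = 1, hence e = 1 = z. This separates the trivial character from all the
    others. *)
Lemma root_trace_neq2 (K : fieldType) (k : nat) (e : K) : ~ root_trace k e 2.
Proof.
move=> [z [zN ze z2]].
have z0 : z != 0.
  by apply: contra_neq ze => z0; rewrite -zN z0 expr0n.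
have : (z - 1) ^+ 2 = 0.
  have -> : (z - 1) ^+ 2 = z * (z + z^-1 - 2) by field.
  by rewrite -z2 subrr mulr0.
move/eqP; rewrite sqrf_eq0 subr_eq0 => /eqP z1.
by move: ze; rewrite -zN z1 expr1n eqxx.
Qed.

(** * Powers of two by two matrices *)

Lemma mxtrace2 (K : pzSemiRingType) (A : 'M[K]_2) : \tr A = A 0 0 + A 1 1.
Proof.
rewrite /mxtrace !big_ord_recl big_ord0 addr0.
by congr (_ + A _ _); apply: val_inj.
Qed.

Lemma mx2P (K : Type) (A B : 'M[K]_2) :
  A 0 0 = B 0 0 -> A 0 1 = B 0 1 -> A 1 0 = B 1 0 -> A 1 1 = B 1 1 -> A = B.
Proof.
move=> e00 e01 e10 e11; apply/matrixP.
by case=> -[|[|//]] i2 [[|[|//]] j2] /=;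
   rewrite ?(bool_irrelevance i2 isT) ?(bool_irrelevance j2 isT);
   [apply: etrans (etrans _ e00) _|apply: etrans (etrans _ e01) _
   |apply: etrans (etrans _ e10) _|apply: etrans (etrans _ e11) _];
   congr (_ _ _); apply: val_inj.
Qed.

Lemma mulmx2E (K : pzSemiRingType) (A B : 'M[K]_2) i j :
  (A * B) i j = A i 0 * B 0 j + A i 1 * B 1 j.
Proof.
rewrite mxE !big_ord_recl big_ord0 addr0.
by congr (_ + A _ _ * B _ _); apply: val_inj.
Qed.

Lemma det_mx2 (K : comNzRingType) (A : 'M[K]_2) :
  \det A = A 0 0 * A 1 1 - A 0 1 * A 1 0.
Proof.
rewrite (expand_det_row _ 0) !big_ord_recl big_ord0 addr0 /cofactor !det_mx11.
rewrite !mxE /= expr0 mul1r expr1 mulN1r mulrN.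
by congr (A _ _ * A _ _ - A _ _ * A _ _); apply: val_inj.
Qed.

Lemma sqr_mx2 (K : comNzRingType) (A : 'M[K]_2) :
  A * A = \tr A *: A - \det A *: 1.
Proof.
rewrite -[1]/(1%:M); apply: mx2P;
rewrite mulmx2E mxtrace2 det_mx2 !mxE /= ?mulr1n ?mulr0n; ring.
Qed.

(** The polarization of the Cayley-Hamilton identity [sqr_mx2]. *)
Lemma mx2_anticomm (K : comNzRingType) (A B : 'M[K]_2) :
  B * A = - (A * B) + \tr A *: B + \tr B *: A
          + (\tr (A * B) - \tr A * \tr B) *: 1.
Proof.
rewrite -[1]/(1%:M); apply: mx2P;
rewrite !(mulmx2E, mxtrace2, mxE) /= ?mulr1n ?mulr0n; ring.
Qed.

Lemma det_scale1 (K : comNzRingType) (c : K) : \det (c *: 1 : 'M_2) = c ^+ 2.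
Proof. by rewrite -[1]/(1%:M) detZ det1 mulr1. Qed.

Lemma det1_unit (K : comUnitRingType) (A : 'M[K]_2) :
  \det A = 1 -> A \is a GRing.unit.
Proof. by move=> dA; rewrite -[_ \is a _]/(A \in unitmx) unitmxE dA unitr1. Qed.

(** The roots of X^2 - tX + 1 have product 1; when t is the trace of a matrix of SL_2, they are its
    eigenvalues. *)
Lemma sum_invE (K : numClosedFieldType) (t : K) :
  exists2 z, z != 0 & t = z + z^-1.
Proof.
have s2 := sqrtCK (t ^+ 2 - 4); set s := sqrtC _ in s2.
have zw : (t + s) / 2 * ((t - s) / 2) = 1.
  have -> : (t + s) / 2 * ((t - s) / 2) = (t ^+ 2 - s ^+ 2) / 4 by field.
  by rewrite s2; field.
have z0 : (t + s) / 2 != 0.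
  by apply: contra_eq_neq zw => ->; rewrite mul0r eq_sym oner_eq0.
exists ((t + s) / 2) => //.
have -> : ((t + s) / 2)^-1 = (t - s) / 2 by apply: (mulfI z0); rewrite mulfV.
by field.
Qed.

(** By Cayley-Hamilton (M - z)(M - 1/z) = 0, so [M] multiplies M - 1/z by the scalar z. No
    diagonalization is involved, so z = 1/z is allowed. *)
Lemma mx2_expr_factor (K : fieldType) (M : 'M[K]_2) (z : K) (k : nat) :
  \det M = 1 -> z != 0 -> \tr M = z + z^-1 ->
  M ^+ k * (M - z^-1 *: 1) = z ^+ k *: (M - z^-1 *: 1).
Proof.
move=> dM z0 tM; elim: k => [|k IHk]; first by rewrite !expr0 mul1r scale1r.
rewrite exprSr -mulrA mulrBr -scalerAr mulr1 sqr_mx2 dM tM.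
have -> : (z + z^-1) *: M - 1 *: 1 - z^-1 *: M = z *: (M - z^-1 *: 1).
  by rewrite scalerDl scalerBr scalerA mulfV // addrAC addrK.
by rewrite -scalerAr IHk scalerA exprS.
Qed.

(** M^(2k+1) - e kills both M - 1/z and M - z, and their difference is a nonzero scalar matrix. *)
Lemma expr_root_trace (K : fieldType) (M : 'M[K]_2) (k : nat) (e : K) :
  e ^+ 2 = 1 -> \det M = 1 -> root_trace k e (\tr M) ->
  M ^+ k.*2.+1 = e *: 1.
Proof.
move=> e2 dM [z [zN ze tM]].
have e0 : e != 0 by rewrite -sqrf_eq0 e2 oner_eq0.
have eV : e^-1 = e by apply: (mulfI e0); rewrite mulfV // -expr2 e2.
have z0 : z != 0 by apply: contraNneq e0 => z0; rewrite -zN z0 expr0n.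
have zV0 : z^-1 != 0 by rewrite invr_eq0.
have tMV : \tr M = z^-1 + z^-1^-1 by rewrite invrK addrC.
(* If z = 1/z, then z^2 = 1 and, the exponent being odd, e = z^(2k+1) = z, which is excluded. *)
have zz : z - z^-1 != 0.
  rewrite subr_eq0; apply: contra ze => /eqP zzV.
  have z2 : z ^+ 2 = 1 by rewrite expr2 {1}zzV mulVf.
  by rewrite -zN exprS -mul2n exprM z2 expr1n mulr1.
have kill w : w != 0 -> \tr M = w + w^-1 -> w ^+ k.*2.+1 = e ->
    (M ^+ k.*2.+1 - e *: 1) * (M - w^-1 *: 1) = 0.
  by move=> w0 tw wN; rewrite mulrBl mx2_expr_factor // wN -scalerAl mul1r subrr.
apply/eqP; rewrite -subr_eq0; apply/eqP/(scalerI zz).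
rewrite scaler0 -[X in _ *: X]mulr1 scalerAr.
have -> : (z - z^-1) *: 1 = M - z^-1 *: 1 - (M - z^-1^-1 *: 1) :> 'M[K]_2.
  by rewrite invrK opprB [RHS]addrC addrA subrK scalerBl.
by rewrite mulrBr !kill ?subrr // exprVn zN.
Qed.

(** With z an eigenvalue, (e - z^(2k+1))(M - 1/z) = 0. Either z^(2k+1) = e, or [M] is a scalar of
    square 1 and equals its odd power [e *: 1]. *)
Lemma root_trace_expr (K : numClosedFieldType) (M : 'M[K]_2) (k : nat) (e : K) :
  e ^+ 2 = 1 -> \det M = 1 -> M ^+ k.*2.+1 = e *: 1 ->
  M = e *: 1 \/ root_trace k e (\tr M).
Proof.
move=> e2 dM MN; have [z z0 tM] := sum_invE (\tr M).
have e0 : e != 0 by rewrite -sqrf_eq0 e2 oner_eq0.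
have eV : e^-1 = e by apply: (mulfI e0); rewrite mulfV // -expr2 e2.
have eN : e ^+ k.*2.+1 = e by rewrite exprS -mul2n exprM e2 expr1n mulr1.
have := mx2_expr_factor k.*2.+1 dM z0 tM.
rewrite MN -scalerAl mul1r => /eqP; rewrite -subr_eq0 -scalerBl scaler_eq0.
rewrite !subr_eq0 => /orP[/eqP zN|/eqP Mz].
  have [ze|ze] := eqVneq z e; last by right; exists z.
  (* Both eigenvalues of [P] are 1, so (P - 1)^2 = 0 and its powers grow linearly; P^(2k+1) = 1 then
     forces P = 1 in characteristic 0. *)
  left; pose P := e *: M.
  have PP : P * P = P *+ 2 - 1.
    rewrite -scalerAl -scalerAr scalerA -expr2 e2 scale1r sqr_mx2 dM tM ze eV.
    by rewrite scale1r -mulr2n -mulr_natl -scalerA scaler_nat.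
  have Pj j : P ^+ j = 1 + (P - 1) *+ j.
    elim: j => [|j IHj]; first by rewrite addr0.
    rewrite exprS IHj mulrDr mulr1 mulrnAr mulrBr mulr1 PP mulr2n.
    by rewrite addrAC addrK mulrS addrA [1 + _]addrC subrK.
  have : P ^+ k.*2.+1 = 1 by rewrite exprZn MN scalerA eN -expr2 e2 scale1r.
  move/eqP; rewrite Pj addrC -subr_eq0 addrK -scaler_nat scaler_eq0 pnatr_eq0 /=.
  by rewrite subr_eq0 => /eqP <-; rewrite scalerA -expr2 e2 scale1r.
have zz : z^-1 ^+ 2 = 1 by rewrite -dM Mz det_scale1.
have zVN : z^-1 ^+ k.*2.+1 = z^-1 by rewrite exprS -mul2n exprM zz expr1n mulr1.
move: MN; rewrite {1}Mz exprZn zVN expr1n => <-; by left.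
Qed.

(** As [s] is its own inverse, the sign of the exponent does not matter. This turns the integer
    exponents of the relations into natural ones. *)
Lemma exprz_sign (R : unitRingType) (x s : R) (k : int) : s * s = 1 ->
  (x ^ k = s) <-> (x ^+ `|k|%N = s).
Proof.
move=> ss; have su : s \is a GRing.unit by apply/unitrP; exists s.
have sV : s^-1 = s by apply: (mulrI su); rewrite mulrV.
case: k => k //; rewrite NegzE -invr_expz abszN; split.
  by move/(congr1 GRing.inv); rewrite invrK sV.
by move=> xk; rewrite -[in RHS]sV -xk.
Qed.

Lemma exprN1z (R : unitRingType) (k : int) : (-1) ^ k = (-1) ^+ `|k|%N :> R.
Proof. by apply/exprz_sign; rewrite // -expr2 sqrr_sign. Qed.

(** * Pairs of matrices satisfying the relations *)

Definition filling_pair (K : fieldType) (n q : int) (A B : 'M[K]_2) :=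
  let M := A * B ^ (- n) in
  [/\ \det A = 1, \det B = 1, A ^+ 2 = B ^ (2 * n + 1)
    & M * (A ^+ 2 * M ^ (- 4 * n - 2)) ^ q = 1].

(** For commuting matrices the longitude is A^(-4n) B^(2n(2n+1)), which is 1 since A^2 = B^(2n+1).
    The slope then gives M = 1, so A = B^n, and B^(2n) = B^(2n+1). *)
Lemma filling_pair_commute (K : fieldType) (n q : int) (A B : 'M[K]_2) :
  filling_pair n q A B -> GRing.comm A B -> A = 1 /\ B = 1.
Proof.
case=> dA dB A2; set M := A * _ => rel cAB.
have uA := det1_unit dA; have uB := det1_unit dB.
have L1 : A ^+ 2 * M ^ (- 4 * n - 2) = 1.
  rewrite exprMz_comm //; last 2 first.
  - by rewrite unitrXz.
  - exact: commrXz.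
  rewrite mulrA exprz_exp -[A ^+ 2]/(A ^ 2%:Z) -exprzDr //.
  have -> : 2%:Z + (- 4 * n - 2) = 2%:Z * (- 2 * n) by ring.
  rewrite -exprz_exp [A ^ 2%:Z]A2 exprz_exp -exprzDr //.
  by rewrite (_ : _ + _ = 0) //; ring.
move: rel; rewrite L1 exp1rz mulr1 => M1.
have AB : A = B ^ n.
  have uBn : B ^ (- n) \is a GRing.unit by rewrite unitrXz.
  by apply: (mulIr uBn); rewrite -/M M1 -exprzDr // subrr.
have B1 : B = 1.
  have uBn : B ^ (2 * n) \is a GRing.unit by rewrite unitrXz.
  apply: (mulrI uBn); rewrite mulr1 -{2}[B]expr1z -exprzDr // -A2 AB.
  by rewrite -[_ ^+ 2]/(_ ^ 2%:Z) exprz_exp mulrC.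
by split=> //; rewrite AB B1 exp1rz.
Qed.

Lemma odd_torus_exponent (n : int) :
  `|(2 * n + 1)%R|%N = (`|torus_genus n|%N).*2.+1.
Proof. rewrite /torus_genus; case: (leP n (- n - 1)%R) => ?; lia. Qed.

(** The integer on the left is the total exponent of the meridian in the filling slope. *)
Lemma odd_filling_exponent (n q : int) :
  `|(1 + (- 4 * n - 2) * q)%R|%N = (tau n q).*2.+1.
Proof.
rewrite /tau; have -> : (4 * n + 2) * q - 1 = - (1 + (- 4 * n - 2) * q) by ring.
rewrite abszN; have : odd `|(1 + (- 4 * n - 2) * q)%R|%N.
  have -> : 1 + (- 4 * n - 2) * q = 1 + 2 * ((- 2 * n - 1) * q) by ring.
  lia.
lia.
Qed.

(** The values of [t_b] at the nontrivial characters, where B^(2n+1) = A^2 = -1. *)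
Definition torus_traces (K : fieldType) (n : int) :=
  root_trace `|torus_genus n|%N (-1 : K).

(** The values of [t_m] at the nontrivial characters. *)
Definition filling_traces (K : fieldType) (n q : int) :=
  root_trace (tau n q) ((-1) ^ q : K).

Lemma det1_exprz (K : fieldType) (A : 'M[K]_2) (k : int) :
  \det A = 1 -> \det (A ^ k) = 1.
Proof.
move=> dA; have natP j : \det (A ^+ j) = 1.
  elim: j => [|j IHj]; first by rewrite -[_ ^+ _]/(1%:M) det1.
  by rewrite exprS -[_ * _]/(_ *m _) det_mulmx dA IHj mulr1.
case: k => k; first exact: natP.
by rewrite NegzE -invr_expz -[_^-1]/(invmx _) det_inv -exprnP natP invr1.
Qed.

(** The matrix -1 is central, so the slope equals (-1)^q times the power of [M] of exponent 1 -
    (4n+2)q, and the sign can be moved to the other side. *)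
Lemma filling_slope_sign (K : fieldType) (n q : int) (A B : 'M[K]_2) :
  \det A = 1 -> \det B = 1 -> A ^+ 2 = -1 ->
  let M := A * B ^ (- n) in
  M * (A ^+ 2 * M ^ (- 4 * n - 2)) ^ q = 1 <->
  M ^+ (tau n q).*2.+1 = (-1) ^ q *: 1.
Proof.
move=> dA dB A2 M.
have uM : M \is a GRing.unit.
  by rewrite unitrMr ?unitrXz ?det1_unit.
have sE : (-1) ^ q = (-1) ^ q *: 1 :> 'M[K]_2.
  by rewrite !exprN1z -[in LHS](scaleN1r 1) exprZn expr1n.
have ss : (-1) ^ q * (-1) ^ q = 1 :> 'M[K]_2 by rewrite exprN1z -expr2 sqrr_sign.
rewrite -odd_filling_exponent -sE -exprz_sign // A2.
rewrite exprMz_comm ?unitrN1 ?unitrXz //; last exact/commr_sym/commrN1.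
have cM : M * (-1) ^ q = (-1) ^ q * M by rewrite exprN1z; apply: commr_sign.
rewrite exprz_exp mulrA cM -mulrA exprzDr // expr1z.
by split=> [h|->//]; rewrite -[LHS]mul1r -{1}ss -mulrA h mulr1.
Qed.

Lemma torus_traceN1 (K : fieldType) (n : int) (B : 'M[K]_2) :
  B ^ (2 * n + 1) = -1 <-> B ^+ (`|torus_genus n|%N).*2.+1 = -1 *: 1.
Proof.
rewrite -odd_torus_exponent scaleN1r.
by apply: exprz_sign; rewrite mulrNN mulr1.
Qed.

Lemma filling_pair_classification (K : numClosedFieldType) (n q : int)
    (A B : 'M[K]_2) :
  filling_pair n q A B ->
  (A = 1 /\ B = 1) \/
  [/\ \tr A = 0, torus_traces n (\tr B)
    & filling_traces n q (\tr (A * B ^ (- n)))].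
Proof.
move=> ABP; have [dA dB A2 rel] := ABP.
have comm1 := filling_pair_commute ABP.
have [tA|tA] := eqVneq (\tr A) 0; last first.
  left; apply: comm1.
  (* Cayley-Hamilton solved for [A]; the right side commutes with [B] because A^2 is a power of
     [B]. *)
  have -> : A = (\tr A)^-1 *: (A ^+ 2 + 1).
    by rewrite expr2 sqr_mx2 dA scale1r subrK scalerA mulVf // scale1r.
  apply/commr_sym; rewrite /GRing.comm -scalerAr -scalerAl; congr (_ *: _).
  apply: commrD (commr1 _); rewrite A2; exact/commrXz.
have A2N : A ^+ 2 = -1 by rewrite expr2 sqr_mx2 dA tA scale0r scale1r sub0r.
(* Commuting would give A = 1, of trace 2. This rules out the scalar cases B = -1 and M = (-1)^q
   below, in which [A] commutes with [B]. *)
have n1 : ~ GRing.comm A B.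
  case/comm1 => A1 _; move/eqP: tA.
  by rewrite A1 -[1]/(1%:M) mxtrace1 pnatr_eq0.
right; split=> //.
  have /torus_traceN1 BN : B ^ (2 * n + 1) = -1 by rewrite -A2.
  case: (root_trace_expr (sqrr_sign K 1) dB BN) => [B1|]; last by [].
  by case: n1; rewrite B1 scaleN1r; apply: commrN1.
set M := A * _ in rel *.
have dM : \det M = 1.
  by rewrite -[M]/(_ *m _) det_mulmx dA det1_exprz ?mulr1.
have /root_trace_expr := (filling_slope_sign n q dA dB A2N).1 rel.
case=> [|//|MN|]; first by rewrite exprN1z sqrr_sign.
  case: n1; have cB : GRing.comm B (B ^ n) by apply: commrXz.
  have -> : A = (-1) ^ q *: B ^ n.
    have uBn : B ^ (- n) \is a GRing.unit by rewrite unitrXz ?det1_unit.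
    apply: (mulIr uBn); apply: etrans MN _; rewrite -scalerAl.
    by rewrite -exprzDr ?det1_unit // subrr.
  by apply/commr_sym; rewrite /GRing.comm -scalerAr -scalerAl cB.
by [].
Qed.

(** * Construction of a pair with prescribed traces *)

Definition mk2 (K : fieldType) (a b c d : K) : 'M[K]_2 :=
  \matrix_(i, j)
    if i == 0 then if j == 0 then a else b else if j == 0 then c else d.

Lemma diag2_exprz (K : fieldType) (z : K) (k : int) : z != 0 ->
  mk2 z 0 0 z^-1 ^ k = mk2 (z ^ k) 0 0 (z ^ k)^-1.
Proof.
move=> z0.
have mulD x y : mk2 x 0 0 x^-1 * mk2 y 0 0 y^-1 = mk2 (x * y) 0 0 (x * y)^-1.
  apply: mx2P; rewrite !mulmx2E !mxE /= !(mulr0, mul0r, addr0, add0r) //.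
  by rewrite invfM.
have D1 : mk2 1 0 0 1^-1 = 1 :> 'M[K]_2.
  by rewrite -[1 in RHS]/(1%:M); apply: mx2P; rewrite !mxE //= invr1.
have natD (x : K) (j : nat) :
    mk2 x 0 0 x^-1 ^+ j = mk2 (x ^+ j) 0 0 (x ^+ j)^-1.
  by elim: j => [|j IHj]; rewrite ?D1 // !exprS IHj mulD.
case: k => k; first exact: natD.
rewrite NegzE -!invr_expz -!exprnP natD.
set w := z ^+ _; have w0 : w != 0 by rewrite expf_neq0.
have ww : mk2 w^-1 0 0 w^-1^-1 * mk2 w 0 0 w^-1 = 1.
  by rewrite mulD mulVf // D1.
have wu : mk2 w 0 0 w^-1 \is a GRing.unit.
  by apply/unitrP; exists (mk2 w^-1 0 0 w^-1^-1); rewrite ww mulD mulfV // D1.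
by apply: (mulIr wu); rewrite mulVr.
Qed.

Lemma filling_pair_exists (K : numClosedFieldType) (n q : int) (x y : K) :
  torus_traces n y -> filling_traces n q x ->
  exists A B, [/\ filling_pair n q A B, \tr (A * B ^ (- n)) = x & \tr B = y].
Proof.
move=> yP xP; have [z [zN zN1 yE]] := yP.
have z0 : z != 0.
  by apply: contra_eq_neq zN => ->; rewrite expr0n eq_sym oppr_eq0 oner_eq0.
(* With [B] diagonal and [A] of diagonal (u, -u), the trace of A B^(-n) is uD, whence u = x / D. The
   off-diagonal entries of [A] make its determinant 1. *)
pose B := mk2 z 0 0 z^-1; pose D := z ^ (- n) - (z ^ (- n))^-1.
pose u := x / D; pose A := mk2 u 1 (- 1 - u ^+ 2) (- u).
have zn : z ^ (2 * n + 1) = -1.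
  by apply/exprz_sign; [rewrite mulrNN mulr1|rewrite odd_torus_exponent].
(* D = 0 means z^(-2n) = 1; together with z^(2n+1) = -1 this gives z = -1, which is excluded. *)
have D0 : D != 0.
  rewrite subr_eq0; apply: contra zN1 => /eqP e.
  have : z ^ (- n) * z ^ (- n) = 1 by rewrite [X in X * _]e mulVf // expfz_neq0.
  rewrite -expfzDr // => e1.
  have <- : z ^ (2 * n + 1) * z ^ (- n - n) = z.
    by rewrite -expfzDr // (_ : 2 * n + 1 + (- n - n) = 1) //; ring.
  by rewrite zn e1 mulr1.
have dB : \det B = 1 by rewrite det_mx2 !mxE /= mulfV // mul0r subr0.
have dA : \det A = 1 by rewrite det_mx2 !mxE /=; ring.
have tB : \tr B = y by rewrite mxtrace2 !mxE /= yE.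
have tA : \tr A = 0 by rewrite mxtrace2 !mxE /= subrr.
have tM : \tr (A * B ^ (- n)) = x.
  rewrite diag2_exprz // mxtrace2 !mulmx2E !mxE /= mulr0 addr0 mulr0 add0r.
  by rewrite mulNr -mulrBr divfK.
have A2 : A ^+ 2 = -1 by rewrite expr2 sqr_mx2 dA tA scale0r scale1r sub0r.
exists A, B; split=> //; split=> //.
  rewrite A2; apply/esym/torus_traceN1.
  by apply: expr_root_trace; rewrite ?tB // sqrrN expr1n.
apply/(filling_slope_sign n q dA dB A2).
apply: expr_root_trace; rewrite ?tM //; first by rewrite exprN1z sqrr_sign.
by rewrite -[_ * _]/(_ *m _) det_mulmx dA det1_exprz ?mulr1.
Qed.

(** * Pairs with the same traces *)

(** For invertible [B], this is Cayley-Hamilton for AB with a factor [B] cancelled on the right;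
    [\tr B *: 1 - B] is the adjugate of [B]. *)
Lemma mx2_sandwich (K : comNzRingType) (A B : 'M[K]_2) :
  A * B * A = \tr (A * B) *: A + \det A *: (B - \tr B *: 1).
Proof.
rewrite -[1]/(1%:M); apply: mx2P;
rewrite !(mulmx2E, mxtrace2, det_mx2, mxE) /= ?mulr1n ?mulr0n; ring.
Qed.

Section SpanPair.
Variables (K : fieldType) (A B A' B' : 'M[K]_2).

(* The structure constants of the algebra spanned by 1, A, B and AB depend only
   on the traces of A, B and AB, so pairs with common coordinates are closed
   under products. *)
Definition span_pair (P P' : 'M[K]_2) := exists a b c d : K,
  P = a *: 1 + b *: A + c *: B + d *: (A * B) /\
  P' = a *: 1 + b *: A' + c *: B' + d *: (A' * B').

Lemma span_pairP k P Q P' Q' : span_pair P P' -> span_pair Q Q' ->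
  span_pair (k *: P + Q) (k *: P' + Q').
Proof.
move=> [a [b [c [d [-> ->]]]]] [a' [b' [c' [d' [-> ->]]]]].
exists (k * a + a'), (k * b + b'), (k * c + c'), (k * d + d').
by rewrite !scalerDr !scalerA !scalerDl; split;
   do 2! (rewrite [LHS]addrACA; congr (_ + _)); exact: addrACA.
Qed.

Lemma span_pair1 : span_pair 1 1.
Proof. by exists 1, 0, 0, 0; rewrite !scale1r !scale0r !addr0. Qed.

Lemma span_pairA : span_pair A A'.
Proof. by exists 0, 1, 0, 0; rewrite !scale1r !scale0r !addr0 !add0r. Qed.

Lemma span_pairB : span_pair B B'.
Proof. by exists 0, 0, 1, 0; rewrite !scale1r !scale0r !addr0 !add0r. Qed.

Lemma span_pairAB : span_pair (A * B) (A' * B').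
Proof. by exists 0, 0, 0, 1; rewrite !scale1r !scale0r !add0r. Qed.

Lemma span_pairD P Q P' Q' : span_pair P P' -> span_pair Q Q' ->
  span_pair (P + Q) (P' + Q').
Proof. by move=> h1 h2; have := span_pairP 1 h1 h2; rewrite !scale1r. Qed.

Lemma span_pairZ k P P' : span_pair P P' -> span_pair (k *: P) (k *: P').
Proof.
move=> [a [b [c [d [-> ->]]]]]; exists (k * a), (k * b), (k * c), (k * d).
by rewrite !scalerDr !scalerA.
Qed.

Hypotheses (dA : \det A = 1) (dB : \det B = 1).
Hypotheses (dA' : \det A' = 1) (dB' : \det B' = 1).
Hypotheses (tA : \tr A = \tr A') (tB : \tr B = \tr B').
Hypothesis tAB : \tr (A * B) = \tr (A' * B').

#[local] Hint Resolve span_pair1 span_pairA span_pairB span_pairAB : core.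

(** The products AA, BA and ABA reduce by Cayley-Hamilton, its polarization and [mx2_sandwich], with
    coefficients made of the common traces and determinants. *)
Lemma span_pairMA P P' : span_pair P P' -> span_pair (P * A) (P' * A').
Proof.
move=> [a [b [c [d [-> ->]]]]]; rewrite !mulrDl -!scalerAl !mul1r.
apply: span_pairD; first apply: span_pairD; first apply: span_pairD;
  apply: span_pairZ; first exact: span_pairA.
- rewrite !sqr_mx2 dA dA' tA -!scaleNr; apply: span_pairP; first exact: span_pairA.
  exact/span_pairZ/span_pair1.
- rewrite (mx2_anticomm A) (mx2_anticomm A') tA tB tAB -!scaleN1r.
  by do !apply: span_pairD; apply: span_pairZ; done.
rewrite !mx2_sandwich dA dA' tB tAB !scale1r -!scaleNr.
by apply: span_pairP; [|apply: span_pairD; [|apply: span_pairZ]]; done.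
Qed.

Lemma span_pairMB P P' : span_pair P P' -> span_pair (P * B) (P' * B').
Proof.
have BB : span_pair (B * B) (B' * B').
  rewrite !sqr_mx2 dB dB' tB -!scaleNr; apply: span_pairP; first exact: span_pairB.
  exact/span_pairZ/span_pair1.
move=> [a [b [c [d [-> ->]]]]]; rewrite !mulrDl -!scalerAl !mul1r.
apply: span_pairD; first apply: span_pairD; first apply: span_pairD;
  apply: span_pairZ => //.
rewrite -!mulrA !sqr_mx2 dB dB' tB -!scaleNr !mulrDr -!scalerAr !mulr1.
by apply: span_pairP; [|apply: span_pairZ]; done.
Qed.

Lemma span_pairM P Q P' Q' : span_pair P P' -> span_pair Q Q' ->
  span_pair (P * Q) (P' * Q').
Proof.
move=> PP [a [b [c [d [-> ->]]]]].
rewrite !mulrDr -!scalerAr !mulr1 !mulrA.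
by do !apply: span_pairD; apply: span_pairZ;
   [|apply: span_pairMA|apply: span_pairMB|apply/span_pairMB/span_pairMA].
Qed.

Lemma span_pair_trace P P' : span_pair P P' -> \tr P = \tr P'.
Proof.
by move=> [a [b [c [d [-> ->]]]]]; rewrite !mxtraceD !mxtraceZ tA tB tAB.
Qed.

End SpanPair.

Lemma SL2_invE (K : fieldType) (X : SL2 K) :
  val X^-1%g = \tr (val X) *: 1 - val X.
Proof.
have dX : \det (val X) = 1 by apply/eqP; case: X.
have uX := det1_unit dX.
apply: (mulrI uX); rewrite mulrBr -scalerAr mulr1 sqr_mx2 dX opprB scale1r.
by rewrite addrC subrK; apply: mulrV.
Qed.

Definition SL2_span_pair (K : fieldType) (A B A' B' X X' : SL2 K) :=
  span_pair (val A) (val B) (val A') (val B') (val X) (val X').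

Lemma SL2_span_pair_closed (K : fieldType) (A B A' B' : SL2 K) :
  \tr (val A) = \tr (val A') -> \tr (val B) = \tr (val B') ->
  \tr (val (A * B)%g) = \tr (val (A' * B')%g) ->
  [/\ SL2_span_pair A B A' B' 1%g 1%g,
      SL2_span_pair A B A' B' A A',
      SL2_span_pair A B A' B' B B',
      (forall X Y X' Y', SL2_span_pair A B A' B' X X' ->
         SL2_span_pair A B A' B' Y Y' ->
         SL2_span_pair A B A' B' (X * Y)%g (X' * Y')%g)
    & forall X X', SL2_span_pair A B A' B' X X' ->
         SL2_span_pair A B A' B' X^-1%g X'^-1%g].
Proof.
move=> tA tB tAB.
have dS (X : SL2 K) : \det (val X) = 1 by apply/eqP; case: X.
have tAB1 : \tr (val A * val B : 'M_2) = \tr (val A' * val B' : 'M_2) := tAB.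
split; [exact: span_pair1|exact: span_pairA|exact: span_pairB| |].
- move=> X Y X' Y' XX YY.
  exact: (@span_pairM _ _ _ _ _ (dS A) (dS B) (dS A') (dS B') tA tB tAB1
    _ _ _ _ XX YY).
- move=> X X' XX; have tX := span_pair_trace tA tB tAB1 XX.
  rewrite /SL2_span_pair !SL2_invE tX -!scaleN1r.
  by apply: span_pairP; [exact: span_pair1|exact: span_pairZ].
Qed.

Lemma SL2_span_pair_expgz (K : fieldType) (A B A' B' X X' : SL2 K) (k : int) :
  \tr (val A) = \tr (val A') -> \tr (val B) = \tr (val B') ->
  \tr (val (A * B)%g) = \tr (val (A' * B')%g) ->
  SL2_span_pair A B A' B' X X' ->
  SL2_span_pair A B A' B' (expgz X k) (expgz X' k).
Proof.
move=> tA tB tAB XX; have [E1 _ _ EM EV] := SL2_span_pair_closed tA tB tAB.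
have EX j : SL2_span_pair A B A' B' (X ^+ j)%g (X' ^+ j)%g.
  by elim: j => [|j IHj]; rewrite ?expg0 ?expgS; [|apply: EM].
by case: k => k /=; [|apply: EV]; exact: EX.
Qed.

(* Taking A = A' = 1, powers of B and B' form a pair with common coordinates. *)
Lemma SL2_trace_expgz (K : fieldType) (B B' : SL2 K) (k : int) :
  \tr (val B) = \tr (val B') -> \tr (val (expgz B k)) = \tr (val (expgz B' k)).
Proof.
move=> tB; have tB1 : \tr (val (1 * B)%g) = \tr (val (1 * B')%g).
  by rewrite !mul1g.
have [_ _ EB _ _] := SL2_span_pair_closed erefl tB tB1.
exact: span_pair_trace (SL2_span_pair_expgz k erefl tB tB1 EB).
Qed.

Lemma val_SL2_expgz (K : fieldType) (X : SL2 K) (k : int) :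
  val (expgz X k) = val X ^ k.
Proof.
have XE j : val (X ^+ j)%g = val X ^+ j.
  by elim: j => [|j IHj]; rewrite ?expg0 // expgS exprS -IHj.
by case: k => k; rewrite ?XE // NegzE -invr_expz -exprnP -XE.
Qed.

(** * Universal properties of free groups and of quotients *)

Lemma multiplicative1 (G H : groupType) (f : {multiplicative G -> H}) :
  f 1%g = 1%g.
Proof. by apply: (mulgI (f 1%g)); rewrite -gmulfM !mulg1. Qed.

Lemma multiplicativeV (G H : groupType) (f : {multiplicative G -> H}) x :
  f x^-1%g = (f x)^-1%g.
Proof. by apply: (mulgI (f x)); rewrite -gmulfM !mulgV multiplicative1. Qed.

Lemma multiplicativeX (G H : groupType) (f : {multiplicative G -> H}) x j :
  f (x ^+ j)%g = (f x ^+ j)%g.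
Proof.
by elim: j => [|j IHj]; rewrite ?expg0 ?multiplicative1 // !expgS gmulfM IHj.
Qed.

Lemma multiplicative_expgz (G H : groupType) (f : {multiplicative G -> H}) x k :
  f (expgz x k) = expgz (f x) k.
Proof. by case: k => k /=; rewrite ?multiplicativeV multiplicativeX. Qed.

HB.instance Definition _ (G : groupType) (S : set G) :=
  isMultiplicative.Build G (normal_quot S) (nquot_pi S)
    (fun g h => esym (nquot_mulE S g h)).

Lemma nquot_pi_surj (G : groupType) (S : set G) (x : normal_quot S) :
  exists g, x = nquot_pi S g.
Proof. by elim/quotW: x => g; exists g. Qed.

Lemma nquot_pi_gen (G : groupType) (S : set G) (s : G) :
  S s -> nquot_pi S s = 1%g.
Proof. by move=> Ss; apply/nquot_piP; rewrite invg1 mulg1; apply: ncl_gen. Qed.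

Lemma normal_quot_lift (G H : groupType) (S : set G)
    (f : {multiplicative G -> H}) :
  (forall s, S s -> f s = 1%g) ->
  exists phi : {multiplicative normal_quot S -> H},
    forall g, phi (nquot_pi S g) = f g.
Proof.
move=> fS; have fN g : normal_closure S g -> f g = 1%g.
  elim=> {g} [s /fS//||g h _ IHg _ IHh|g _ IHg|g h _ IHg].
  - exact: multiplicative1.
  - by rewrite gmulfM IHg IHh mulg1.
  - by rewrite multiplicativeV IHg invg1.
  - by rewrite conjgE !gmulfM multiplicativeV IHg mul1g mulVg.
(* By [fN] the value does not depend on the representative chosen by [repr]. *)
pose phi (x : normal_quot S) := f (repr x).
have phiE g : phi (nquot_pi S g) = f g.
  have := fN _ (nquot_repr S g); rewrite gmulfM multiplicativeV.
  exact: divg1_eq.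
have phiM : {morph phi : x y / (x * y)%g}.
  move=> x y; have [g ->] := nquot_pi_surj x; have [h ->] := nquot_pi_surj y.
  by rewrite -gmulfM !phiE gmulfM.
by exists (HB.pack_for {multiplicative normal_quot S -> H} phi
  (isMultiplicative.Build _ _ phi phiM)).
Qed.

Lemma free_group_ind (X : choiceType) (P : free_group X -> Prop) :
  P 1%g -> (forall g h, P g -> P h -> P (g * h)%g) ->
  (forall g, P g -> P g^-1%g) ->
  (forall x, P (free_gen x)) -> forall g, P g.
Proof.
move=> P1 PM PV Pg; elim/quotW; elim=> [|[x e] w IHw]; first exact: P1.
have -> : \pi_(free_group X) ((x, e) :: w) =
    (\pi_(free_group X) [:: (x, e)] * \pi_(free_group X) w)%g.
  by rewrite -[RHS]/(free_mul _ _) free_mulE.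
apply: PM IHw; case: e; first exact: Pg.
have -> : \pi_(free_group X) [:: (x, false)] = (free_gen x)^-1%g.
  by rewrite -[RHS]/(free_inv _) free_invE.
exact/PV/Pg.
Qed.

Lemma free_group_lift (X : choiceType) (G : groupType) (f : X -> G) :
  exists phi : {multiplicative free_group X -> G},
    forall x, phi (free_gen x) = f x.
Proof.
pose letter (l : X * bool) := if l.2 then f l.1 else (f l.1)^-1%g.
pose ev (w : word X) := foldr (fun l g => letter l * g)%g 1%g w.
have ev_cat u v : ev (u ++ v) = (ev u * ev v)%g.
  by elim: u => [|l u IHu] /=; rewrite ?mul1g // IHu mulgA.
have evE u v : free_eq u v -> ev u = ev v.
  elim=> {u v} [//|//|u v w _ -> _ ->//|u x e v].
  rewrite !ev_cat /=; congr (_ * _)%g; rewrite mulgA.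
  by case: e; rewrite /letter /= ?mulgV ?mulVg mul1g.
pose phi (x : free_group X) := ev (repr x).
have phiE w : phi (\pi_(free_group X) w) = ev w by apply/evE/free_repr.
have phiM : {morph phi : x y / (x * y)%g}.
  elim/quotW=> u; elim/quotW=> v.
  by rewrite -[(_ * _)%g in LHS]/(free_mul _ _) free_mulE !phiE ev_cat.
exists (HB.pack_for {multiplicative free_group X -> G} phi
  (isMultiplicative.Build _ _ phi phiM)) => x /=.
by rewrite phiE /ev /= mulg1.
Qed.

(** * Representations of the filling group *)

Definition filling_a (n q : int) : filling_group n q :=
  nquot_pi [set filling_slope n q] (knot_a n).

Lemma knot_relation (n : int) :
  (knot_a n ^+ 2)%g = expgz (knot_b n) (2 * n + 1).
Proof.
have := @nquot_pi_gen _ [set torus_relator n] (torus_relator n) erefl.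
rewrite /torus_relator gmulfM multiplicativeV => /divg1_eq.
by rewrite multiplicativeX multiplicative_expgz.
Qed.

Lemma filling_torus_relation (n q : int) :
  (filling_a n q ^+ 2)%g = expgz (filling_b n q) (2 * n + 1).
Proof.
by rewrite /filling_a -multiplicativeX knot_relation multiplicative_expgz.
Qed.

Lemma filling_mE (n q : int) :
  filling_m n q = (filling_a n q * expgz (filling_b n q) (- n))%g.
Proof. by rewrite /filling_m /knot_meridian gmulfM multiplicative_expgz. Qed.

Lemma filling_slope_relation (n q : int) :
  (filling_m n q *
   expgz (filling_a n q ^+ 2 * expgz (filling_m n q) (- 4 * n - 2)) q)%g = 1%g.
Proof.
have := @nquot_pi_gen _ [set filling_slope n q] (filling_slope n q) erefl.
rewrite {1 3}/filling_slope gmulfM multiplicative_expgz (gmulfM (knot_a n ^+ 2)%g).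
by rewrite multiplicativeX multiplicative_expgz.
Qed.

Lemma filling_group_ind (n q : int) (P : filling_group n q -> Prop) :
  P 1%g -> (forall g h, P g -> P h -> P (g * h)%g) ->
  (forall g, P g -> P g^-1%g) ->
  P (filling_a n q) -> P (filling_b n q) -> forall g, P g.
Proof.
move=> P1 PM PV Pa Pb x.
have [y ->] := nquot_pi_surj x; have [g ->] := nquot_pi_surj y.
elim/free_group_ind: g => [|g h|g|[]].
- by rewrite !multiplicative1.
- by rewrite !gmulfM; apply: PM.
- by rewrite !multiplicativeV; apply: PV.
- exact: Pa.
- exact: Pb.
Qed.

Lemma val_SL2X (K : fieldType) (X : SL2 K) j : val (X ^+ j)%g = val X ^+ j.
Proof. by have := val_SL2_expgz X j. Qed.

Lemma val_SL2M (K : fieldType) (X Y : SL2 K) : val (X * Y)%g = val X * val Y.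
Proof. by []. Qed.

Section Representations.
Variables (K : fieldType) (n q : int).

Lemma filling_rep_meridian (rho : {multiplicative filling_group n q -> SL2 K}) :
  val (rho (filling_m n q)) =
  val (rho (filling_a n q)) * val (rho (filling_b n q)) ^ (- n).
Proof. by rewrite filling_mE gmulfM multiplicative_expgz -val_SL2_expgz. Qed.

Lemma filling_pair_rep (rho : {multiplicative filling_group n q -> SL2 K}) :
  filling_pair n q (val (rho (filling_a n q))) (val (rho (filling_b n q))).
Proof.
split; [by apply/eqP; case: (rho _)|by apply/eqP; case: (rho _)| |].
  by rewrite -val_SL2_expgz -val_SL2X -multiplicativeX -multiplicative_expgz
             filling_torus_relation.
rewrite -filling_rep_meridian.
have /(congr1 (fun g => val (rho g))) := filling_slope_relation n q.
rewrite gmulfM multiplicative_expgz gmulfM multiplicativeX multiplicative_expgz.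
rewrite multiplicative1 => rel; apply: etrans rel.
by rewrite !(val_SL2M, val_SL2_expgz, val_SL2X).
Qed.

(** The map is defined on the free group and descends twice: the third condition on the pair kills
    the torus relator, the fourth the filling slope. *)
Lemma rep_filling_pair (A B : 'M[K]_2) : filling_pair n q A B ->
  exists rho : {multiplicative filling_group n q -> SL2 K},
    val (rho (filling_a n q)) = A /\ val (rho (filling_b n q)) = B.
Proof.
case=> dA dB A2 rel.
pose X : SL2 K := exist _ A (introT eqP dA : is_SL2 A).
pose Y : SL2 K := exist _ B (introT eqP dB : is_SL2 B).
have [f fE] := free_group_lift (fun x : bool => if x then X else Y).
have [|g gE] := @normal_quot_lift _ _ [set torus_relator n] f.
  move=> _ ->; rewrite /torus_relator gmulfM multiplicativeV multiplicativeX.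
  rewrite multiplicative_expgz !fE; apply/eqP; rewrite divg_eq1.
  apply/eqP/val_inj.
  by rewrite val_SL2X val_SL2_expgz.
have ga : g (knot_a n) = X by rewrite gE fE.
have gb : g (knot_b n) = Y by rewrite gE fE.
have [|h hE] := @normal_quot_lift _ _ [set filling_slope n q] g.
  move=> _ ->; rewrite /filling_slope gmulfM multiplicative_expgz.
  rewrite (gmulfM (knot_a n ^+ 2)%g) multiplicativeX multiplicative_expgz.
  rewrite /knot_meridian gmulfM multiplicative_expgz ga gb; apply: val_inj.
  rewrite -[RHS]/(1 : 'M[K]_2) -[RHS]rel.
  by rewrite !(val_SL2M, val_SL2_expgz, val_SL2X).
by exists h; rewrite !hE ga gb.
Qed.

(** The span argument needs the traces of two generators and of their product. The trace at ab is
    not given, so b is replaced by c = b^(-n), for which ac = m. *)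
Lemma filling_character_inj
    (rho rho' : {multiplicative filling_group n q -> SL2 K}) :
  \tr (val (rho (filling_a n q))) = \tr (val (rho' (filling_a n q))) ->
  \tr (val (rho (filling_b n q))) = \tr (val (rho' (filling_b n q))) ->
  \tr (val (rho (filling_m n q))) = \tr (val (rho' (filling_m n q))) ->
  forall g, \tr (val (rho g)) = \tr (val (rho' g)).
Proof.
set a := filling_a n q; set b := filling_b n q => ta tb tm.
set c := expgz b (- n).
have tc : \tr (val (rho c)) = \tr (val (rho' c)).
  by rewrite /c !multiplicative_expgz; apply: SL2_trace_expgz.
have tac : \tr (val (rho a * rho c)%g) = \tr (val (rho' a * rho' c)%g).
  by rewrite -!gmulfM /c -filling_mE.
have [E1 Ea Ec EM EV] := SL2_span_pair_closed ta tc tac.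
(* Here b = b^(2n+1) b^(-2n), so a and c generate the group. *)
have bE (r : {multiplicative filling_group n q -> SL2 K}) :
    r b = (r a * r a * (r c * r c))%g.
  have [_ dB A2 _] := filling_pair_rep r; have uB := det1_unit dB.
  apply: val_inj; rewrite !val_SL2M.
  rewrite multiplicative_expgz val_SL2_expgz -exprzDr // -expr2 A2 -exprzDr //.
  by rewrite (_ : 2 * n + 1 + (- n - n) = 1) //; ring.
have EE g : SL2_span_pair (rho a) (rho c) (rho' a) (rho' c) (rho g) (rho' g).
  elim/filling_group_ind: g => [|g h|g||].
  - by rewrite !multiplicative1.
  - by rewrite !gmulfM; apply: EM.
  - by rewrite !multiplicativeV; apply: EV.
  - exact: Ea.
  - rewrite -/b !bE.
    exact: EM (EM _ _ _ _ Ea Ea) (EM _ _ _ _ Ec Ec).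
by move=> g; apply: span_pair_trace (EE g).
Qed.

End Representations.

(** * Characters and their coordinates [t_m], [t_b] *)

Section Characters.
Variables (K : numClosedFieldType) (n q : int).
Implicit Types rho : {multiplicative filling_group n q -> SL2 K}.

Lemma filling_rep_classification rho :
  let ta := \tr (val (rho (filling_a n q))) in
  let tb := \tr (val (rho (filling_b n q))) in
  let tm := \tr (val (rho (filling_m n q))) in
  [/\ ta = 2, tb = 2 & tm = 2] \/
  [/\ ta = 0, torus_traces n tb & filling_traces n q tm].
Proof.
move=> ta tb tm; rewrite /tm filling_rep_meridian /ta /tb.
have tr1 : \tr (1 : 'M[K]_2) = 2 by exact: mxtrace1.
have [[-> ->]|] := filling_pair_classification (filling_pair_rep rho);
  last by right.
by left; rewrite exp1rz mulr1 tr1.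
Qed.

(** The trace at a is 2 or 0, and the trace at m tells which: it is 2 exactly at the trivial
    character. *)
Lemma filling_character_coords rho rho' :
  \tr (val (rho (filling_b n q))) = \tr (val (rho' (filling_b n q))) ->
  \tr (val (rho (filling_m n q))) = \tr (val (rho' (filling_m n q))) ->
  forall g, \tr (val (rho g)) = \tr (val (rho' g)).
Proof.
move=> tb tm; apply: filling_character_inj => //.
case: (filling_rep_classification rho) (filling_rep_classification rho').
  move=> [-> _ tm2] [[-> //]|[_ _]]; rewrite -tm tm2.
  by move/root_trace_neq2.
move=> [-> _ xP] [[_ _ tm2]|[-> //]].
by move: xP; rewrite tm tm2 => /root_trace_neq2.
Qed.

Lemma trivial_filling_rep_exists : exists rho,
  \tr (val (rho (filling_m n q))) = 2 /\ \tr (val (rho (filling_b n q))) = 2.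
Proof.
have [|rho [rA rB]] := @rep_filling_pair K n q 1 1.
  by split; rewrite ?det1 ?exp1rz ?mulr1 ?expr1n ?mul1r ?exp1rz.
exists rho; rewrite filling_rep_meridian rA rB exp1rz mulr1.
by split; exact: mxtrace1.
Qed.

Lemma filling_rep_exists x y : torus_traces n y -> filling_traces n q x ->
  exists rho,
  \tr (val (rho (filling_m n q))) = x /\ \tr (val (rho (filling_b n q))) = y.
Proof.
move=> yP xP; have [A [B [AB tM tB]]] := filling_pair_exists yP xP.
have [rho [rA rB]] := rep_filling_pair AB.
by exists rho; rewrite filling_rep_meridian rA rB.
Qed.

End Characters.

(** * Bases of rings of functions on a finite set *)

Lemma sum_option (V : nmodType) (T : finType) (F : option T -> V) :
  \sum_l F l = F None + \sum_t F (Some t).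
Proof.
rewrite (bigD1 None) //=; congr (_ + _).
rewrite (reindex_omap Some id) /=; last by case.
by apply: eq_bigl => t; rewrite eqxx.
Qed.

(** Passes from an indexed family to its set of values, on which [is_basis] is stated. Freeness
    makes [F] injective, so coefficients can be carried between indices and vectors. *)
Lemma basis_range (K : fieldType) (V : lmodType K) (I : finType) (F : I -> V) :
  (forall c : I -> K, \sum_i c i *: F i = 0 -> forall i, c i = 0) ->
  (forall w, exists c : I -> K, w = \sum_i c i *: F i) ->
  is_basis (range F).
Proof.
move=> freeF spanF.
have F_inj : injective F.
  move=> i j Fij; apply/eqP/negPn/negP => ij.
  (* The relation F i - F j = 0 has coefficient 1 at i if i and j differ. *)
  have := freeF (fun k => (k == i)%:R - (k == j)%:R).
  have sum1 k : \sum_l (l == k)%:R *: F l = F k.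
    rewrite (bigD1 k) //= eqxx scale1r big1 ?addr0 // => l lk.
    by rewrite (negPf lk) scale0r.
  under eq_bigr do rewrite scalerBl.
  rewrite sumrB !sum1 Fij subrr => /(_ erefl i).
  by rewrite eqxx (negPf ij) subr0 => /eqP; rewrite oner_eq0.
split=> [s c s_uniq sF sum0 v vs|w].
  have sE : perm_eq s (map F [seq i <- enum I | F i \in s]).
    apply: uniq_perm => // [|u].
      by rewrite (map_inj_uniq F_inj) filter_uniq ?enum_uniq.
    apply/idP/mapP => [us|[i + ->]]; last by rewrite mem_filter => /andP[].
    have [i _ iu] := sF u us; exists i => //.
    by rewrite mem_filter mem_enum iu us.
  have [i _ iv] := sF v vs.
  have := freeF (fun j => if F j \in s then c (F j) else 0).
  have -> : \sum_j (if F j \in s then c (F j) else 0) *: F j = 0.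
    rewrite -[RHS]sum0 (perm_big _ sE) big_map big_filter big_enum_cond /=.
    rewrite [RHS]big_mkcond; apply: eq_bigr => j _.
    by case: ifP; rewrite ?scale0r.
  by move=> /(_ erefl i); rewrite iv vs.
have [c ->] := spanF w.
exists [seq F i | i <- enum I], (fun v => \sum_(i | F i == v) c i).
split=> [v /mapP[i _ ->]|]; first by exists i.
rewrite big_map big_enum; apply: eq_bigr => i _; congr (_ *: _).
by rewrite (big_pred1 i) // => j; rewrite (inj_eq F_inj).
Qed.

(* A square system of linear equations with trivial kernel is solvable. *)
Lemma free_evaluation_span (K : fieldType) (I : finType) (E : I -> I -> K) :
  (forall c : I -> K,
     (forall i, \sum_j c j * E j i = 0) -> forall j, c j = 0) ->
  forall w : I -> K, exists c : I -> K, forall i, w i = \sum_j c j * E j i.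
Proof.
move=> freeE w.
pose A := \matrix_(j < #|I|, i < #|I|) E (enum_val j) (enum_val i).
have mulA (v : 'rV_#|I|) i :
    (v *m A) 0 (enum_rank i) = \sum_j v 0 (enum_rank j) * E j i.
  rewrite mxE [RHS](reindex (fun k : 'I_#|I| => enum_val k)) /=;
    last exact/onW_bij/enum_val_bij.
  by apply: eq_bigr => j _; rewrite mxE enum_rankK enum_valK.
have uA : A \in unitmx.
  rewrite -row_free_unit; apply: inj_row_free => v vA.
  have v0 := freeE (fun j => v 0 (enum_rank j)).
  apply/rowP => k; rewrite mxE -[k]enum_valK v0 // => i.
  by rewrite -mulA vA mxE.
exists (fun j => ((\row_k w (enum_val k)) *m invmx A) 0 (enum_rank j)) => i.
by rewrite -mulA mulmxKV // mxE enum_rankK.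
Qed.

Lemma poly_eq0_roots (K : fieldType) (p : {poly K}) (s : seq K) :
  uniq s -> (size p <= size s)%N -> {in s, forall x, p.[x] = 0} -> p = 0.
Proof.
move=> s_uniq ps p0; apply/eqP; apply: contraTT ps => pn0; rewrite -ltnNge.
by apply: max_poly_roots => //; apply/allP => x /p0/eqP.
Qed.

(** Let Phi be the product of the X - z over [xs]. Vanishing on the grid forces f(x, y) = c Phi(x)
    for all x and y. As Phi(x0) is nonzero, c = 0, and then every coefficient of f vanishes. *)
Lemma grid_point_free (K : fieldType) (xs ys : seq K) (x0 y0 : K)
    (d : nat -> nat -> K) (c : K) :
  let f x y := \sum_(i < size xs) \sum_(j < size ys) d i j * (x ^+ i * y ^+ j)
               + c * x ^+ size xs in
  uniq xs -> uniq ys -> x0 \notin xs -> x0 != 0 ->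
  (forall x y, x \in xs -> y \in ys -> f x y = 0) -> f x0 y0 = 0 ->
  c = 0 /\ forall i j, (i < size xs)%N -> (j < size ys)%N -> d i j = 0.
Proof.
move=> f xs_uniq ys_uniq x0xs x00 fgrid f0.
(* With an empty grid only the term c x^(size xs) is left, and x0 is nonzero. *)
have [ys0|ys_gt0] := posnP (size ys).
  split=> [|i j _]; last by rewrite ys0.
  move: f0; rewrite /f big1 ?add0r => [/eqP|i _]; last by rewrite ys0 big_ord0.
  by rewrite mulf_eq0 expf_eq0 (negPf x00) andbF orbF => /eqP.
have fE x y : f x y =
    \sum_(i < size xs) (\sum_(j < size ys) d i j * y ^+ j) * x ^+ i
    + c * x ^+ size xs.
  rewrite /f; congr (_ + _); apply: eq_bigr => i _; rewrite mulr_suml.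
  by apply: eq_bigr => j _; rewrite mulrA mulrAC.
pose Phi := \prod_(z <- xs) ('X - z%:P).
have szPhi : size Phi = (size xs).+1 by rewrite size_prod_XsubC.
have PhiE x : Phi.[x] = \sum_(i < size xs) Phi`_i * x ^+ i + x ^+ size xs.
  rewrite horner_coef szPhi big_ord_recr /=; congr (_ + _).
  have /monicP := monic_prod_XsubC xs xpredT id.
  by rewrite lead_coefE -/Phi szPhi /= => ->; rewrite mul1r.
have Phi0 x : x \in xs -> Phi.[x] = 0.
  by move=> xxs; apply/eqP; rewrite -/(root _ _) root_prod_XsubC.
(* For fixed y, [p] is f(X, y) - c Phi: the leading terms cancel, so its degree is below the number
   of its roots in [xs]. *)
have rowE y : y \in ys -> forall i, (i < size xs)%N ->
    \sum_(j < size ys) d i j * y ^+ j = c * Phi`_i.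
  move=> yys i ixs.
  pose p := \poly_(k < size xs) (\sum_(j < size ys) d k j * y ^+ j - c * Phi`_k).
  have p0 : p = 0.
    apply: (poly_eq0_roots xs_uniq); first exact: size_poly.
    move=> x xxs; rewrite horner_poly; under eq_bigr do rewrite mulrBl.
    rewrite sumrB; have := fgrid x y xxs yys; rewrite fE => /eqP.
    rewrite addr_eq0 => /eqP ->; have := Phi0 x xxs; rewrite PhiE => /eqP.
    rewrite addr_eq0 => /eqP PhiS; under eq_bigr do rewrite -mulrA.
    by rewrite -mulr_sumr PhiS mulrN subrr.
  have : p`_i = 0 by rewrite p0 coef0.
  by rewrite coef_poly ixs => /eqP; rewrite subr_eq0 => /eqP.
(* Both sides agree on [ys]. The constant on the right respects the degree bound because [ys] is
   nonempty. *)
have colE i : (i < size xs)%N ->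
    \poly_(j < size ys) d i j = (c * Phi`_i)%:P.
  move=> ixs; apply/eqP; rewrite -subr_eq0; apply/eqP/(poly_eq0_roots ys_uniq).
    apply: leq_trans (size_polyD _ _) _.
    rewrite geq_max size_poly size_polyN size_polyC; case: (_ != 0) => //.
  by move=> y yys; rewrite hornerD hornerN hornerC horner_poly rowE ?subrr.
have c0 : c = 0.
  have : c * Phi.[x0] = 0.
    rewrite PhiE mulrDr mulr_sumr -[RHS]f0 fE; congr (_ + _).
    apply: eq_bigr => i _.
    by rewrite mulrA -horner_poly colE // hornerC.
  move/eqP; rewrite mulf_eq0 => /orP[/eqP//|].
  by rewrite -/(root _ _) root_prod_XsubC (negPf x0xs).
split=> // i j ixs jys.
have := congr1 (fun p : {poly K} => p`_j) (colE i ixs).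
by rewrite c0 mul0r coef0 coef_poly jys.
Qed.

(** * Evaluation of regular functions at characters *)

Section CoordRing.
Variables (R : realType) (G : groupType).
Implicit Types f h : coord_ring R G.

Definition coord_eval (chi : char_variety R G) f : R[i] := val f chi.

Lemma coord_evalM chi f h :
  coord_eval chi (f * h) = coord_eval chi f * coord_eval chi h.
Proof. by []. Qed.

Lemma coord_evalX chi f k : coord_eval chi (f ^+ k) = coord_eval chi f ^+ k.
Proof. by elim: k => [|k IHk]; rewrite // !exprS coord_evalM IHk. Qed.

Lemma coord_eval_sum chi (I : finType) (c : I -> R[i]) (F : I -> coord_ring R G) :
  coord_eval chi (\sum_i c i *: F i) = \sum_i c i * coord_eval chi (F i).
Proof.
by rewrite (big_morph (coord_eval chi) (id1 := 0) (op1 := +%R)).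
Qed.

Lemma coord_ringP f h :
  (forall chi, coord_eval chi f = coord_eval chi h) -> f = h.
Proof. by move=> fh; apply: val_inj; apply/funext. Qed.

End CoordRing.

Theorem theorem8p7 (R : realType) (n q : int) :
  let t := @trace_fun R (filling_group n q) in
  let t_m := t (filling_m n q) in
  let t_b := t (filling_b n q) in
  is_basis
    ([set f : coord_ring R (filling_group n q) |
        exists i j : nat, [/\ (i < tau n q)%N, j%:Z < torus_genus n &
                              f = t_m ^+ i * t_b ^+ j]]
     `|` [set t_m ^+ tau n q]).
Proof.
move=> t t_m t_b; pose g := `|torus_genus n|%N.
(* The genus is nonnegative for every [n], so its absolute value gives the same bound. *)
have gE j : (j%:Z < torus_genus n) = (j < g)%N.
  rewrite /g /torus_genus; case: (leP n (- n - 1)%R) => ?; lia.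
have e2 : ((-1) ^ q) ^+ 2 = 1 :> R[i] by rewrite exprN1z sqrr_sign.
have [xs [xs_uniq xs_size xsP]] := root_traces_enum (tau n q) e2.
have [ys [ys_uniq ys_size ysP]] := root_traces_enum g (sqrr_sign R[i] 1).
pose I : finType := option ('I_(tau n q) * 'I_g).
pose F (k : I) : coord_ring R (filling_group n q) :=
  if k is Some (i, j) then t_m ^+ i * t_b ^+ j else t_m ^+ tau n q.
have -> : [set f : coord_ring R (filling_group n q) |
        exists i j : nat, [/\ (i < tau n q)%N, j%:Z < torus_genus n &
                              f = t_m ^+ i * t_b ^+ j]]
     `|` [set t_m ^+ tau n q] = range F.
  apply/seteqP; split=> [f [[i [j [it]]]|->]|f [[[i j]|] _ <-]].
  - by rewrite gE => jg ->; exists (Some (Ordinal it, Ordinal jg)).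
  - by exists None.
  - by left; exists i, j; rewrite gE !ltn_ord.
  - by right.
(* The index type of the functions [F] also labels the points, [None] standing for the trivial
   character; this makes the evaluation system square. *)
pose pt (k : I) : R[i] * R[i] :=
  if k is Some (i, j) then (xs`_i, ys`_j) else (2, 2).
pose coords (chi : char_variety R (filling_group n q)) : R[i] * R[i] :=
  (coord_eval chi t_m, coord_eval chi t_b).
have coordsE rho (chi := exist _ (sl2_character rho) (ex_intro _ rho erefl)) :
  coords chi =
    (\tr (val (rho (filling_m n q))), \tr (val (rho (filling_b n q)))).
  by [].
have coords_inj : injective coords.
  move=> [chi1 [rho1 E1]] [chi2 [rho2 E2]]; subst chi1 chi2 => -[tm tb].
  have E : sl2_character rho1 = sl2_character rho2.
    by apply/funext => h; apply: filling_character_coords.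
  by apply: eq_exist.
have pt_ex (k : I) : exists chi, coords chi = pt k.
  have [rho [tm tb]] :
    exists rho : {multiplicative filling_group n q -> SL2 R[i]},
    \tr (val (rho (filling_m n q))) = (pt k).1 /\
    \tr (val (rho (filling_b n q))) = (pt k).2.
    case: k => [[i j]|]; last exact: trivial_filling_rep_exists.
    apply: filling_rep_exists; [apply/ysP|apply/xsP]; apply: mem_nth.
      by rewrite ys_size.
    by rewrite xs_size.
  exists (exist _ (sl2_character rho) (ex_intro _ rho erefl)).
  by rewrite coordsE tm tb; case: (pt k).
have [p pE] := choice pt_ex.
(* The points [p k] exhaust the variety, so a regular function is determined by its values there. *)
have p_surj chi : exists k, chi = p k.
  have [k ck] : exists k, coords chi = pt k.
    case: chi => chi [rho E]; subst chi; rewrite coordsE.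
    case: (filling_rep_classification rho) => [[_ -> ->]|[_ /ysP yP /xsP xP]].
      by exists None.
    move: xP yP; rewrite -!index_mem => ix iy.
    have ix' := ix; have iy' := iy; rewrite xs_size in ix; rewrite ys_size in iy.
    exists (Some (Ordinal ix, Ordinal iy)) => /=.
    by rewrite !nth_index -?index_mem.
  by exists k; apply: coords_inj; rewrite ck pE.
have EF k (x := (pt k).1) (y := (pt k).2) l : coord_eval (p k) (F l) =
    if l is Some (i, j) then x ^+ i * y ^+ j else x ^+ tau n q.
  rewrite /x /y -pE /coords /=.
  by case: l => [[i j]|]; rewrite ?coord_evalM !coord_evalX.
have freeE (c : I -> R[i]) :
  (forall k, \sum_l c l * coord_eval (p k) (F l) = 0) -> forall l, c l = 0.
  move=> c0.
  (* The coefficients are extended by 0 to all natural indices, the form required by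
     [grid_point_free]. *)
  pose d i j :=
    if (insub i, insub j) is (Some i', Some j') then c (Some (i', j')) else 0.
  have dE (i : 'I_(tau n q)) (j : 'I_g) : d i j = c (Some (i, j)).
    by rewrite /d !valK.
  have sumE k (x := (pt k).1) (y := (pt k).2) :
    \sum_(i < size xs) \sum_(j < size ys) d i j * (x ^+ i * y ^+ j)
      + c None * x ^+ size xs = 0.
    rewrite xs_size ys_size -[RHS](c0 k) sum_option addrC EF; congr (_ + _).
    by rewrite pair_bigA; apply: eq_bigr => -[i j] _; rewrite EF dE.
  have [||||x y xxs yys||c_None c_grid] := @grid_point_free _ xs ys 2 2 d (c None).
  - exact: xs_uniq.
  - exact: ys_uniq.
  - by apply/negP => /xsP /root_trace_neq2.
  - by rewrite pnatr_eq0.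
  - have ix := xxs; have iy := yys; rewrite -index_mem xs_size in ix.
    rewrite -index_mem ys_size in iy.
    have := sumE (Some (Ordinal ix, Ordinal iy)).
    by rewrite /= !nth_index.
  - exact: sumE None.
  by case=> [[i j]|//]; rewrite -dE c_grid ?xs_size ?ys_size.
apply: basis_range => [c c0|w].
  by apply: freeE => k; rewrite -coord_eval_sum c0.
(* The coefficients are found by interpolating the values of [w] at all the points. *)
have [c cE] := free_evaluation_span freeE (fun k => coord_eval (p k) w).
exists c; apply: coord_ringP => chi; have [k ->] := p_surj chi.
by rewrite coord_eval_sum cE.
Qed.
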